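(* Let $M\ge1$, $D=2^M$, and let $\ell\ge1$ be an integer, $N=2^\ell$. There is a fixed sequence of the elementary operations ''prepare'' and ''merge'' acting on $\ell+1$ data registers of $M$ qubits each (hence $(\ell+1)M$ data qubits in total), consisting of exactly $N$ preparations and exactly $N-1$ merges, which realizes the $\ell$-round binary-tree SWAP-test circuit on $N$ copies of $\rho$: for every density matrix $\rho$ on $\mathbb{C}^D$, after identifying the $N-1$ merges of the sequence with the $N-1$ internal nodes of the binary tree, each outcome string $\vec\sigma_\ell\in\{\pm1\}^{N-1}$ occurs with probability $P_{\vec\sigma_\ell}$, and, whenever this probability is positive, the state left in a designated output register conditional on $\vec\sigma_\ell$ is $\rho_{\vec\sigma_\ell}$.
   Context: SWAP gadget. For density matrices $X,Y$ on $\mathbb{C}^D$, let $\mathrm{SWAP}$ exchange the two tensor factors $A,B$ of $\mathbb{C}^D\otimes\mathbb{C}^D$ and $\Pi_\pm=\frac12(I\pm\mathrm{SWAP})$. The gadget measures $\{\Pi_+,\Pi_-\}$ on $X\otimes Y$ and discards the register $B$. Outcome $\sigma\in\{+1,-1\}$ has probability $P_{\sigma|X,Y}=\frac12(1+\sigma\,\mathrm{Tr}[XY])$ and, when this is positive, yields the state $$\rho_\sigma(X,Y)=\frac{X+Y+\sigma(XY+YX)}{4P_{\sigma|X,Y}}.$$ Elementary operations on data registers. ''Prepare'' on a free register: (re)initialize it to a fresh copy of $\rho$, independent of all other registers; the register becomes occupied. ''Merge'' on two occupied registers $i,j$: apply the SWAP gadget to their contents, record the outcome $\sigma$, keep the resulting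 state in register $i$, and discard the content of register $j$, which becomes free. All registers are initially free. Ancilla qubits used for the SWAP measurement are not counted as data qubits. Binary-tree circuit. For $\ell=1$: $P_{\sigma_1}=\frac12(1+\sigma_1\mathrm{Tr}(\rho^2))$ and $\rho_{\sigma_1}=\rho_{\sigma_1}(\rho,\rho)$. An outcome string for $\ell+1$ rounds is a triple $(\vec\alpha,\vec\beta,\sigma)$, where $\vec\alpha,\vec\beta$ are outcome strings of two independent $\ell$-round subtrees and $\sigma\in\{\pm1\}$ is the outcome of the SWAP gadget merging their outputs, with $$P_{(\vec\alpha,\vec\beta,\sigma)}=P_{\vec\alpha}P_{\vec\beta}\,\tfrac12\left(1+\sigma\,\mathrm{Tr}[\rho_{\vec\alpha}\rho_{\vec\beta}]\right),\qquad \rho_{(\vec\alpha,\vec\beta,\sigma)}=\rho_\sigma(\rho_{\vec\alpha},\rho_{\vec\beta}),$$ where $P_{(\vec\alpha,\vec\beta,\sigma)}=0$ if $P_{\vec\alpha}P_{\vec\beta}=0$, and the conditional state is defined only for branches of positive probability. *)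

(* Defs.v *)
From HB Require Import structures.
From mathcomp Require Import all_boot all_order all_algebra.
From mathcomp Require Import spectral.
From mathcomp Require Import reals.
From mathcomp.real_closed Require Import complex mxtens.

Set Implicit Arguments.
Unset Strict Implicit.
Unset Printing Implicit Defensive.

Import Order.TTheory GRing.Theory Num.Theory.
Local Open Scope ring_scope.
Local Open Scope sesquilinear_scope.

(* Over a numClosedFieldType, 0 <= z says that z is real and nonnegative. *)
Definition density_matrix (C : numClosedFieldType) (D : nat) (X : 'M[C]_D) :
    Prop :=
  [/\ X^t* = X,
      forall v : 'cV[C]_D, 0 <= (v^t* *m X *m v) 0 0
    & \tr X = 1].

(* A measurement outcome in {+1, -1} is a boolean: false is +1, true is -1. *)
Definition sgn (C : numClosedFieldType) (s : bool) : C := (-1) ^+ s.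

Section Gadget.
Variables (C : numClosedFieldType) (D : nat).
Implicit Types (X Y : 'M[C]_D) (Z : 'M[C]_(D * D)) (s : bool).

(* The basis vector e_a (x) e_b of C^D (x) C^D has index mxtens_index (a, b),
   and X (x) Y is tensmx X Y. SWAP maps e_a (x) e_b to e_b (x) e_a. *)
Definition SWAP : 'M[C]_(D * D) :=
  \matrix_(p, q) ((mxtens_unindex p == ((mxtens_unindex q).2,
                                        (mxtens_unindex q).1))%:R).

Definition swap_proj s : 'M[C]_(D * D) := 2^-1 *: (1%:M + sgn C s *: SWAP).

Definition ptraceB Z : 'M[C]_D :=
  \matrix_(i, j) \sum_k Z (mxtens_index (i, k)) (mxtens_index (j, k)).

(* The gadget as a physical process: the projective measurement of
   {Pi_+, Pi_-} on X (x) Y followed by discarding the register B. The state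
   is meaningful only when the probability is nonzero. *)
Definition gadget_prob s X Y : C := \tr (swap_proj s *m tensmx X Y).

Definition gadget_state s X Y : 'M[C]_D :=
  (gadget_prob s X Y)^-1 *:
    ptraceB (swap_proj s *m tensmx X Y *m swap_proj s).

(* The closed formulas for P_(s | X, Y) and rho_s(X, Y), out of which the
   binary-tree circuit is built. *)
Definition swap_prob s X Y : C := 2^-1 * (1 + sgn C s * \tr (X *m Y)).

Definition swap_state s X Y : 'M[C]_D :=
  (4 * swap_prob s X Y)^-1 *: (X + Y + sgn C s *: (X *m Y + Y *m X)).

End Gadget.

(* The internal nodes of the complete binary tree of depth l: None is the root,
   Some (inl v) and Some (inr v) are the nodes of the two subtrees. *)
Fixpoint node (l : nat) : finType :=
  if l is l'.+1 then option (node l' + node l')%type else void.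

Lemma card_node (l : nat) : #|node l| = (2 ^ l - 1)%N.
Proof.
elim: l => [|l IHl]; first by rewrite card_void.
rewrite /= card_option card_sum IHl expnS mul2n -addnn.
by rewrite -[in RHS](subnK (expn_gt0 2 l : (0 < 2 ^ l)%N)) addnA addnK !addn1.
Qed.

Section Tree.
Variables (C : numClosedFieldType) (D : nat) (rho : 'M[C]_D).

(* An outcome string for l rounds is a map node l -> bool; the triple
   (alpha, beta, s) consists of its restrictions to the two subtrees and its
   value at the root. *)
Definition lsub (l : nat) (sigma : node l.+1 -> bool) : node l -> bool :=
  fun v => sigma (Some (inl v)).
Definition rsub (l : nat) (sigma : node l.+1 -> bool) : node l -> bool :=
  fun v => sigma (Some (inr v)).

(* The recursion starts at l = 0 with a single copy of rho; tree_state1 and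
   tree_prob1 give back the clauses for one round. The value of tree_state on
   a branch of probability 0 is meaningless. *)
Fixpoint tree_state (l : nat) : (node l -> bool) -> 'M[C]_D :=
  if l is l'.+1 return (node l -> bool) -> 'M[C]_D then
    fun sigma => swap_state (sigma None) (tree_state (lsub sigma))
                                         (tree_state (rsub sigma))
  else fun=> rho.

Fixpoint tree_prob (l : nat) : (node l -> bool) -> C :=
  if l is l'.+1 return (node l -> bool) -> C then
    fun sigma =>
      tree_prob (lsub sigma) * tree_prob (rsub sigma) *
      swap_prob (sigma None) (tree_state (lsub sigma))
                             (tree_state (rsub sigma))
  else fun=> 1.

Lemma tree_state1 (sigma : node 1 -> bool) :
  tree_state sigma = swap_state (sigma None) rho rho.
Proof. by []. Qed.

Lemma tree_prob1 (sigma : node 1 -> bool) :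
  tree_prob sigma = 2^-1 * (1 + sgn C (sigma None) * \tr (rho *m rho)).
Proof. by rewrite /= !mul1r. Qed.

End Tree.

(* Elementary operations on n data registers. *)
Inductive op (n : nat) : Type :=
| Prepare of 'I_n
| Merge of 'I_n & 'I_n.

Definition is_prepare (n : nat) (o : op n) : bool :=
  if o is Prepare _ then true else false.
Definition is_merge (n : nat) (o : op n) : bool :=
  if o is Merge _ _ then true else false.

Section Machine.
Variables (C : numClosedFieldType) (D n : nat) (rho : 'M[C]_D).

(* The contents of the registers conditional on the outcomes recorded so far;
   None is a free register. Distinct registers are independent: their joint
   state is the tensor product of the contents of the occupied ones. *)
Definition regs := {ffun 'I_n -> option 'M[C]_D}.

Definition all_free : regs := [ffun=> None].

Definition set_reg (r : regs) (i : 'I_n) (x : option 'M[C]_D) : regs :=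
  [ffun k => if k == i then x else r k].

(* run p ss w r executes p from register contents r, reached with probability
   w, along the branch in which the successive merges have the outcomes ss. It
   returns the probability of that branch and the final contents, or None if
   some operation is not allowed or if the length of ss is not the number of
   merges. *)
Fixpoint run (p : seq (op n)) (ss : seq bool) (w : C) (r : regs) :
    option (C * regs) :=
  match p with
  | [::] => if ss is [::] then Some (w, r) else None
  | Prepare i :: p' =>
      if r i is None then run p' ss w (set_reg r i (Some rho)) else None
  | Merge i j :: p' =>
      match ss, r i, r j with
      | s :: ss', Some X, Some Y =>
          if i == j then None
          else run p' ss' (w * gadget_prob s X Y)
                 (set_reg (set_reg r i (Some (gadget_state s X Y))) j None)
      | _, _, _ => None
      end
  end.

End Machine.

(* Main.v *)
(* A tree of depth l+1 is evaluated in the registers i, ..., i+l+1 depth first: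
   the left subtree leaves its output in register i and frees the others, so
   the right subtree fits in the l+1 registers from i+1 on, and merging i with
   i+1 puts the output in i. Unit trace is what identifies the
   physical gadget with the closed formulas. On a branch of probability 0 the
   register contents may differ from [tree_state], but then both accumulated
   weights already vanish. *)
From HB Require Import structures.
Require Import Defs.
From mathcomp Require Import all_boot all_order all_algebra.
From mathcomp Require Import reals ring.
From mathcomp.real_closed Require Import complex mxtens.

Set Implicit Arguments.
Unset Strict Implicit.
Unset Printing Implicit Defensive.

Import Order.TTheory GRing.Theory Num.Theory.
Local Open Scope ring_scope.
Local Open Scope complex_scope.

Section GadgetFormulas.
Variables (C : numClosedFieldType) (D : nat).
Implicit Types (X Y : 'M[C]_D) (Z : 'M[C]_(D * D)) (s : bool).

Lemma SWAP_mull Z a b q :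
  (SWAP C D *m Z) (mxtens_index (a, b)) q = Z (mxtens_index (b, a)) q.
Proof.
rewrite mxE (bigD1 (mxtens_index (b, a))) //= big1 => [|p neq_p].
  by rewrite mxE !mxtens_indexK eqxx mul1r addr0.
rewrite mxE mxtens_indexK; case: eqP => [eq_p|_]; last by rewrite mul0r.
case/eqP: neq_p; rewrite -[p]mxtens_unindexK.
by case: (mxtens_unindex p) eq_p => c d [-> ->].
Qed.

Lemma SWAP_mulr Z p a b :
  (Z *m SWAP C D) p (mxtens_index (a, b)) = Z p (mxtens_index (b, a)).
Proof.
rewrite mxE (bigD1 (mxtens_index (b, a))) //= big1 => [|q neq_q].
  by rewrite mxE !mxtens_indexK eqxx mulr1 addr0.
rewrite mxE mxtens_indexK; case: eqP => [eq_q|_]; last by rewrite mulr0.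
by rewrite -[q]mxtens_unindexK eq_q eqxx in neq_q.
Qed.

Lemma ptraceB_is_linear : linear (@ptraceB C D).
Proof.
move=> a Z1 Z2; apply/matrixP=> i j; rewrite !mxE mulr_sumr -big_split /=.
by apply: eq_bigr => k _; rewrite !mxE.
Qed.

HB.instance Definition _ := GRing.isLinear.Build C 'M[C]_(D * D) 'M[C]_D _
  (@ptraceB C D) ptraceB_is_linear.

(** Lets the outcome probability be computed from the same partial traces as the output state. *)
Lemma mxtrace_ptraceB Z : \tr (ptraceB Z) = \tr Z.
Proof.
rewrite /mxtrace; under eq_bigr do rewrite mxE.
rewrite pair_bigA (reindex (@mxtens_unindex D D)).
  apply: eq_bigr => p _; rewrite -[in RHS](mxtens_unindexK p).
  by case: (mxtens_unindex p).
by exists (@mxtens_index D D) => p _; rewrite ?mxtens_indexK ?mxtens_unindexK.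
Qed.

Lemma ptraceB_tens X Y : ptraceB (tensmx X Y) = \tr Y *: X.
Proof.
apply/matrixP=> i j; rewrite !mxE [RHS]mulrC mulr_sumr.
by apply: eq_bigr => k _; rewrite tensmxE.
Qed.

Lemma ptraceB_SWAP_tens X Y : ptraceB (SWAP C D *m tensmx X Y) = Y *m X.
Proof.
apply/matrixP=> i j; rewrite !mxE; apply: eq_bigr => k _.
by rewrite SWAP_mull tensmxE mulrC.
Qed.

Lemma ptraceB_tens_SWAP X Y : ptraceB (tensmx X Y *m SWAP C D) = X *m Y.
Proof.
apply/matrixP=> i j; rewrite !mxE; apply: eq_bigr => k _.
by rewrite SWAP_mulr tensmxE.
Qed.

Lemma ptraceB_SWAP_tens_SWAP X Y :
  ptraceB (SWAP C D *m tensmx X Y *m SWAP C D) = \tr X *: Y.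
Proof.
apply/matrixP=> i j; rewrite !mxE mulr_suml; apply: eq_bigr => k _.
by rewrite SWAP_mulr SWAP_mull tensmxE.
Qed.

Lemma gadget_probE s X Y :
  \tr X = 1 -> \tr Y = 1 -> gadget_prob s X Y = swap_prob s X Y.
Proof.
move=> trX trY; rewrite /gadget_prob /swap_prob -mxtrace_ptraceB /swap_proj.
rewrite -scalemxAl mulmxDl mul1mx -scalemxAl !linearZ linearD linearZ /=.
rewrite ptraceB_tens ptraceB_SWAP_tens trY scale1r.
by rewrite mxtraceD mxtraceZ trX mxtrace_mulC.
Qed.

Lemma sgn_sqr s : sgn C s * sgn C s = 1.
Proof. by rewrite /sgn -expr2 sqrr_sign. Qed.

(** Expanding both projectors around [tensmx X Y] gives four terms whose partial traces are, by unit
    trace, X, YX, XY and Y; the last carries the square of the sign, which is 1. *)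
Lemma gadget_stateE s X Y :
  \tr X = 1 -> \tr Y = 1 -> gadget_state s X Y = swap_state s X Y.
Proof.
move=> trX trY; rewrite /gadget_state /swap_state gadget_probE // (invfM 4).
rewrite [X in _ = X *: _]mulrC -scalerA; congr (_ *: _).
rewrite /swap_proj -!scalemxAl -scalemxAr scalerA !linearZ /=.
(* The factors 1/2 of the two projectors make up the 1/4 of the closed formula. *)
congr (_ *: _); first by rewrite -invfM -natrM.
rewrite mulmxDl mul1mx mulmxDr mulmx1 -!scalemxAl -scalemxAr mulmxDl -scalemxAl.
rewrite scalerDr scalerA sgn_sqr scale1r !linearD !linearZ /=.
rewrite ptraceB_tens ptraceB_SWAP_tens ptraceB_tens_SWAP ptraceB_SWAP_tens_SWAP.
rewrite trX trY !scale1r [in LHS](addrC _ Y) addrACA.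
by rewrite [sgn C s *: (Y *m X) + _]addrC.
Qed.

(** Carries the unit-trace hypothesis of the gadget formulas up the tree; the normalisation cancels
    only when the probability is nonzero. *)
Lemma mxtrace_swap_state s X Y :
  \tr X = 1 -> \tr Y = 1 -> swap_prob s X Y != 0 -> \tr (swap_state s X Y) = 1.
Proof.
move=> trX trY p_neq0; rewrite /swap_state mxtraceZ.
suff -> : \tr (X + Y + sgn C s *: (X *m Y + Y *m X)) = 4 * swap_prob s X Y.
  by rewrite mulVf // mulf_neq0 // pnatr_eq0.
rewrite mxtraceD mxtraceZ !mxtraceD trX trY (mxtrace_mulC Y X) /swap_prob.
by field.
Qed.

End GadgetFormulas.

(** The order in which a depth-first evaluation performs its merges, hence the order in which [run]
    consumes the outcomes. *)
Fixpoint postorder (l : nat) : seq (node l) :=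
  if l is l'.+1 return seq (node l) then
    [seq Some (inl v) | v <- postorder l'] ++
    [seq Some (inr v) | v <- postorder l'] ++ [:: None]
  else [::].

Lemma size_postorder l : size (postorder l) = (2 ^ l - 1)%N.
Proof.
rewrite -card_node; elim: l => [|l IHl] /=; first by rewrite card_void.
by rewrite !size_cat !size_map IHl card_option card_sum addnA addn1.
Qed.

Lemma mem_postorder l v : v \in postorder l.
Proof.
elim: l v => [|l IHl] //= [[v|v]|]; rewrite !mem_cat.
- by rewrite map_f.
- by rewrite map_f ?orbT.
- by rewrite mem_head !orbT.
Qed.

(** A list that covers [node l] and is no longer than its cardinality cannot repeat an entry. *)
Lemma uniq_postorder l : uniq (postorder l).
Proof.
apply: (@leq_size_uniq _ (enum (node l))); first exact: enum_uniq.
  by move=> v _; apply: mem_postorder.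
by rewrite size_postorder -cardE card_node.
Qed.

Lemma postorder_enum l : exists2 phi : 'I_(2 ^ l - 1) -> node l,
  bijective phi & [seq phi k | k <- enum 'I_(2 ^ l - 1)] = postorder l.
Proof.
have sz : size (postorder l) == (2 ^ l - 1)%N by rewrite size_postorder.
exists (tnth (Tuple sz)); last exact: map_tnth_enum.
apply: inj_card_bij; last by rewrite card_node card_ord.
by apply/tuple_uniqP; apply: uniq_postorder.
Qed.

Section Program.
Variable n : nat.

(** Registers are counted in [nat] so that the recursion can shift to [i.+1]; [inord] is faithful as
    long as [i + l <= n]. *)
Fixpoint tree_prog (l i : nat) : seq (op n.+1) :=
  if l is l'.+1 then
    tree_prog l' i ++ tree_prog l' i.+1 ++ [:: Merge (inord i) (inord i.+1)]
  else [:: Prepare (inord i)].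

Lemma count_prepare_tree_prog l i :
  count (@is_prepare n.+1) (tree_prog l i) = (2 ^ l)%N.
Proof.
elim: l i => [|l IHl] i //=.
by rewrite !count_cat !IHl /= !addn0 addnn expnS mul2n.
Qed.

Lemma count_merge_tree_prog l i :
  count (@is_merge n.+1) (tree_prog l i) = (2 ^ l - 1)%N.
Proof.
rewrite -size_postorder; elim: l i => [|l IHl] i //=.
by rewrite !count_cat !IHl !size_cat !size_map.
Qed.

Variables (C : numClosedFieldType) (D : nat) (rho : 'M[C]_D).
Hypothesis tr_rho : \tr rho = 1.

(** The arbitrary continuation [p], [ss] and start [w], [r] let the induction hypotheses chain along
    the concatenated program. Only register [i] differs at the end, so the scratch registers are
    free for reuse. *)
Lemma run_tree_prog l (sigma : node l -> bool) : exists2 X : 'M[C]_D,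
    tree_prob rho sigma != 0 -> X = tree_state rho sigma /\ \tr X = 1
  & forall i p ss w (r : regs C D n.+1), (i + l <= n)%N ->
      (forall k : 'I_n.+1, (i <= k <= i + l)%N -> r k = None) ->
      run rho (tree_prog l i ++ p) ([seq sigma v | v <- postorder l] ++ ss) w r
        = run rho p ss (w * tree_prob rho sigma)
              (set_reg r (inord i) (Some X)).
Proof.
elim: l sigma => [|l IHl] sigma.
  exists rho => // i p ss w r; rewrite addn0 => le_in r_free /=.
  by rewrite r_free ?mulr1 // inordK // leqnn.
have [X stX runX] := IHl (lsub sigma); have [Y stY runY] := IHl (rsub sigma).
(* If a subtree branch has probability 0, both sides vanish whatever [X] and [Y] are; otherwise both
   have unit trace and [gadget_probE] applies. *)
have probE : tree_prob rho (lsub sigma) * tree_prob rho (rsub sigma) *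
    gadget_prob (sigma None) X Y = tree_prob rho sigma.
  rewrite [RHS]/=; have [-> | ] := eqVneq (tree_prob rho (lsub sigma) *
    tree_prob rho (rsub sigma)) 0; first by rewrite !mul0r.
  rewrite mulf_eq0 negb_or => /andP[/stX[eqX trX] /stY[eqY trY]].
  by rewrite gadget_probE // eqX eqY.
exists (gadget_state (sigma None) X Y) => [|i p ss w r].
  rewrite /= mulf_eq0 negb_or => /andP[neq0 p_neq0]; move: (neq0).
  rewrite mulf_eq0 negb_or => /andP[/stX[eqX trX] /stY[eqY trY]].
  rewrite gadget_stateE // eqX eqY; split=> //.
  by apply: mxtrace_swap_state; rewrite -?eqX -?eqY // eqX eqY.
rewrite addnS -probE => lt_iln r_free /=.
have le_iln := ltnW lt_iln.
have lt_in : (i < n.+1)%N by rewrite ltnS (leq_trans (leq_addr l i)).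
have lt_i1n : (i.+1 < n.+1)%N.
  by rewrite ltnS (leq_trans _ lt_iln) // ltnS leq_addr.
have neq_i : (inord i == inord i.+1 :> 'I_n.+1) = false.
  by rewrite -val_eqE /= !inordK // -[X in X == _]addn0 -addn1 eqn_add2l.
rewrite !map_cat -!map_comp -!catA runX //; last first.
  by move=> k /andP[ik kil]; rewrite r_free // ik leqW.
(* The left output sits in register [i], just below the range from [i.+1] to [i.+1 + l] that the
   right subtree needs free. *)
rewrite runY; first last.
- move=> k /andP[ik kil]; rewrite ffunE -val_eqE /= inordK //.
  by rewrite gtn_eqF // r_free // -addSn kil ltnW.
- by rewrite addSn.
rewrite /= !ffunE eqxx neq_i eqxx; congr run; first by rewrite !mulrA.
(* The merge empties register [i.+1], which was free in [r] too, and overwrites the left output in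
   register [i]. *)
apply/ffunP=> k; rewrite !ffunE; case: (eqVneq k (inord i.+1)) => [->|_].
  rewrite eq_sym neq_i r_free // inordK //.
  by rewrite leqnSn ltnS leq_addr.
by case: (k == inord i).
Qed.

End Program.

Theorem mainTheorem6 (R : realType) (M l : nat) (hM : (1 <= M)%N)
    (hl : (1 <= l)%N) :
  exists (p : seq (op l.+1)) (out : 'I_l.+1) (phi : 'I_(2 ^ l - 1) -> node l),
    [/\ count (@is_prepare l.+1) p = (2 ^ l)%N,
        count (@is_merge l.+1) p = (2 ^ l - 1)%N,
        bijective phi
      & forall rho : 'M[R[i]]_(2 ^ M), density_matrix rho ->
        forall sigma : node l -> bool,
        exists r : regs R[i] (2 ^ M) l.+1,
          run rho p [seq sigma (phi k) | k <- enum 'I_(2 ^ l - 1)]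
              1 (all_free R[i] (2 ^ M) l.+1)
            = Some (tree_prob rho sigma, r) /\
          (0 < tree_prob rho sigma -> r out = Some (tree_state rho sigma))].
Proof.
have [phi phi_bij phiE] := postorder_enum l.
exists (tree_prog l l 0), (inord 0), phi; split=> //.
- exact: count_prepare_tree_prog.
- exact: count_merge_tree_prog.
move=> rho [_ _ tr_rho] sigma.
have [X stX runX] := run_tree_prog l tr_rho sigma.
exists (set_reg (all_free _ _ _) (inord 0) (Some X)); split.
  (* By [phiE] the outcomes arrive in postorder; [cats0] supplies empty continuations. *)
  rewrite map_comp phiE -[tree_prog _ _ _]cats0 -[map _ _]cats0 runX //=.
    by rewrite mul1r.
  by move=> k _; rewrite ffunE.
by move=> /lt0r_neq0 /stX[<- _]; rewrite ffunE eqxx.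
Qed.
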